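(* Let $R,T$ be commutative rings with identity, $f:R\to T$ a ring homomorphism, $J$ an ideal of $T$, $M$ an $R$-module, $N$ a $T$-module (regarded as an $R$-module via $f$), $\varphi:M\to N$ an $R$-module homomorphism, and $F$ a submodule of $M$. Then: (1) If $F$ is the intersection of two distinct prime submodules of $M$, then $F\bowtie^{\varphi}JN$ is a 2-absorbing submodule of the $(R\bowtie^{f}J)$-module $M\bowtie^{\varphi}JN$. (2) If $M$ is a cyclic $R$-module and $(F:_R M)$ is a 2-absorbing ideal of $R$, then $F\bowtie^{\varphi}JN$ is a 2-absorbing submodule of $M\bowtie^{\varphi}JN$. (3) If $M$ is a cyclic $R$-module, $P$ is a prime ideal of $R$, and $F$ is a $P$-primary submodule of $M$ such that $(PM)^2\subseteq F$, then $F\bowtie^{\varphi}JN$ is a 2-absorbing submodule of $M\bowtie^{\varphi}JN$.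
   Context: All rings are commutative with identity and all modules are unital. For a submodule $F$ of an $R$-module $M$, $(F:_R M)=\{r\in R: rM\subseteq F\}$. A proper submodule $F$ of $M$ is 2-absorbing if whenever $a,b\in R$, $m\in M$ and $abm\in F$, then $ab\in(F:_R M)$ or $am\in F$ or $bm\in F$. A nonzero proper ideal $I$ of $R$ is a 2-absorbing ideal if whenever $a,b,c\in R$ and $abc\in I$, then $ab\in I$ or $ac\in I$ or $bc\in I$. A proper submodule $F$ of $M$ is prime if $rm\in F$ ($r\in R$, $m\in M$) implies $m\in F$ or $r\in(F:_R M)$. A proper submodule $F$ is primary if $rm\in F$ implies $m\in F$ or $r^k\in(F:_R M)$ for some $k\ge1$, and $P$-primary if moreover $\sqrt{(F:_R M)}=P$. In a cyclic (more generally, multiplication) module, the product of submodules $IM$ and $I'M$ is $II'M$, so $(PM)^2=P^2M$. $R\bowtie^{f}J=\{(r,f(r)+j): r\in R,\ j\in J\}$ is a subring of $R\times T$. $M\bowtie^{\varphi}JN=\{(m,\varphi(m)+n): m\in M,\ n\in JN\}$ is an $(R\bowtie^{f}J)$-module under $(r,f(r)+j)\cdot(m,\varphi(m)+n)=(rm,\varphi(rm)+f(r)n+j\varphi(m)+jn)$, and $F\bowtie^{\varphi}JN=\{(m,\varphi(m)+n): m\in F,\ n\in JN\}$ is a submodule of it. *)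

(* Defs.v *)
From HB Require Import structures.
From mathcomp Require Import all_boot all_algebra.
From mathcomp Require Import boolp classical_sets.

Set Implicit Arguments.
Unset Strict Implicit.
Unset Printing Implicit Defensive.

Import GRing.Theory.
Local Open Scope classical_set_scope.
Local Open Scope ring_scope.

Section Submodules.
Variables (A : comPzRingType) (V : lmodType A).
Implicit Types (F K L X : set V) (I : set A).

Definition submodule F : Prop := GRing.submod_closed [in F].

(* (F :_A V) *)
Definition colon F : set A := [set r | forall m : V, F (r *: m)].

Definition two_absorbing_submodule F : Prop :=
  [/\ submodule F, F <> setT &
      forall (a b : A) (m : V), F ((a * b) *: m) ->
        [\/ colon F (a * b), F (a *: m) | F (b *: m)]].

Definition prime_submodule F : Prop :=
  [/\ submodule F, F <> setT &
      forall (r : A) (m : V), F (r *: m) -> F m \/ colon F r].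

Definition primary_submodule F : Prop :=
  [/\ submodule F, F <> setT &
      forall (r : A) (m : V), F (r *: m) ->
        F m \/ exists2 k : nat, (1 <= k)%N & colon F (r ^+ k)].

(* I X: finite sums of products of elements of I and X. *)
Definition setsmul I X : set V :=
  [set y | exists2 s : seq (A * V),
     forall p, p \in s -> I p.1 /\ X p.2 & y = \sum_(p <- s) p.1 *: p.2].

End Submodules.

Definition cyclic_module (A : comPzRingType) (V : lmodType A) : Prop :=
  exists x : V, forall m : V, exists r : A, m = r *: x.

Section Ideals.
Variable A : comPzRingType.
Implicit Types I P : set A.

Definition ideal I : Prop := @submodule A A^o I.

Definition ideal_mul I P : set A := @setsmul A A^o I P.

Definition prime_ideal P : Prop :=
  [/\ ideal P, P <> setT & forall a b : A, P (a * b) -> P a \/ P b].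

Definition two_absorbing_ideal I : Prop :=
  [/\ ideal I, I <> [set 0], I <> setT &
      forall a b c : A, I (a * b * c) ->
        [\/ I (a * b), I (a * c) | I (b * c)]].

Definition radical I : set A :=
  [set r | exists2 k : nat, (1 <= k)%N & I (r ^+ k)].

End Ideals.

Section SubmoduleProducts.
Variables (A : comPzRingType) (V : lmodType A).

Definition P_primary (P : set A) (F : set V) : Prop :=
  primary_submodule F /\ radical (colon F) = P.

(* The product of I V and I' V is I I' V. This depends only on the two
   submodules and not on the presenting ideals (submodule_mulE), so the union
   below, over all presentations K = I V and L = I' V, has at most one
   distinct term. *)
Definition submodule_mul (K L : set V) : set V :=
  [set y | exists I I' : set A,
     [/\ ideal I, ideal I', K = setsmul I [set: V], L = setsmul I' [set: V] &
         setsmul (ideal_mul I I') [set: V] y]].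

Lemma setsmul0 (I : set A) (X : set V) : setsmul I X 0.
Proof. by exists [::]; rewrite ?big_nil. Qed.

Lemma setsmulD (I : set A) (X : set V) u v :
  setsmul I X u -> setsmul I X v -> setsmul I X (u + v).
Proof.
move=> [s sIX ->] [t tIX ->]; exists (s ++ t); last by rewrite big_cat.
by move=> p; rewrite mem_cat => /orP[/sIX|/tIX].
Qed.

Lemma setsmulT_scale (I : set A) a u :
  setsmul I [set: V] u -> setsmul I [set: V] (a *: u).
Proof.
move=> [s sI ->]; exists [seq (p.1, a *: p.2) | p <- s].
  by move=> _ /mapP[q /sI[Iq _] ->].
rewrite big_map scaler_sumr; apply: eq_bigr => p _ /=.
by rewrite !scalerA mulrC.
Qed.

Lemma setsmulT_submodule (I : set A) : submodule (setsmul I [set: V]).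
Proof.
split=> [|a u v]; first exact/mem_set/setsmul0.
move=> /set_mem Iu /set_mem Iv; apply/mem_set/setsmulD => //.
exact: setsmulT_scale.
Qed.

Lemma setsmul1 (I : set A) (X : set V) a x : I a -> X x -> setsmul I X (a *: x).
Proof.
move=> Ia Xx; exists [:: (a, x)]; last by rewrite big_seq1.
by move=> p; rewrite inE => /eqP ->.
Qed.

Lemma setsmul_ind (I : set A) (X F : set V) :
  F 0 -> (forall u v, F u -> F v -> F (u + v)) ->
  (forall a x, I a -> X x -> F (a *: x)) -> setsmul I X `<=` F.
Proof.
move=> F0 FD FZ _ [s sIX ->].
have: forall p, p \in s -> F (p.1 *: p.2).
  by move=> p /sIX[]; apply: FZ.
elim: s {sIX} => [|p s IHs] sF; first by rewrite big_nil.
rewrite big_cons; apply: FD; first by apply: sF; rewrite mem_head.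
by apply: IHs => q qs; apply: sF; rewrite in_cons qs orbT.
Qed.

End SubmoduleProducts.

Lemma setsmul_mul (A : comPzRingType) (V : lmodType A) (I I' : set A) :
  setsmul (ideal_mul I I') [set: V] = setsmul I (setsmul I' [set: V]).
Proof.
apply/seteqP; split; apply: setsmul_ind; try exact: setsmul0;
  try exact: setsmulD.
- move=> a x Ia _; move: a Ia.
  apply: (@setsmul_ind A A^o _ _
    [set a | setsmul I (setsmul I' [set: V]) (a *: x)]) => /=.
  + by rewrite scale0r; exact: setsmul0.
  + by move=> u v Iu Iv; rewrite scalerDl; exact: setsmulD.
  + move=> a b Ia I'b; rewrite -[(a *: b : A^o)]/(a * b) -scalerA.
    by apply: setsmul1 => //; exact: setsmul1.
- move=> a x Ia; move: x.
  apply: (@setsmul_ind A V _ _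
    [set x | setsmul (ideal_mul I I') [set: V] (a *: x)]) => /=.
  + by rewrite scaler0; exact: setsmul0.
  + by move=> u v Iu Iv; rewrite scalerDr; exact: setsmulD.
  + move=> b x I'b _; rewrite scalerA; apply: setsmul1 => //.
    exact: (@setsmul1 A A^o).
Qed.

Lemma submodule_mulE (A : comPzRingType) (V : lmodType A) (I I' : set A) :
  ideal I -> ideal I' ->
  submodule_mul (setsmul I [set: V]) (setsmul I' [set: V])
  = setsmul (ideal_mul I I') [set: V].
Proof.
have mulC (K L : set A) : ideal_mul K L = ideal_mul L K.
  by apply/seteqP; split=> _ [s sP ->];
     (exists [seq (p.2, p.1) | p <- s];
       [ by move=> _ /mapP[q /sP[? ?] ->]
       | by rewrite big_map; apply: eq_bigr => p _; apply: mulrC ]).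
move=> idI idI'; apply/seteqP; split=> y; last by move=> Hy; exists I, I'.
move=> [K [K' [_ _ eqK eqK']]].
by rewrite setsmul_mul -eqK' -setsmul_mul mulC setsmul_mul -eqK -setsmul_mul mulC.
Qed.

Lemma ideal_add (A : comPzRingType) (I : set A) u v :
  ideal I -> I u -> I v -> I (u + v).
Proof.
move=> idI /mem_set Iu /mem_set Iv.
by have /set_mem := idI.2 1 u v Iu Iv; rewrite scale1r.
Qed.

Lemma ideal_mull (A : comPzRingType) (I : set A) a u :
  ideal I -> I u -> I (a * u).
Proof.
move=> idI /mem_set Iu.
by have /set_mem := idI.2 a u 0 Iu idI.1; rewrite addr0.
Qed.

Section AmalgamatedRing.
Variables (R T : comPzRingType) (f : {rmorphism R -> T}) (J : set T).

Definition amalg_set : set (R * T) :=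
  [set x | exists r j, J j /\ x = (r, f r + j)].

Lemma amalg_setE x : amalg_set x <-> J (x.2 - f x.1).
Proof.
split=> [[r [j [Jj ->]]]|Jx]; first by rewrite /= addrAC subrr add0r.
by exists x.1, (x.2 - f x.1); rewrite [f _ + _]addrC subrK; case: x Jx.
Qed.

Lemma amalg_subring_closed : ideal J -> GRing.subring_closed [in amalg_set].
Proof.
move=> idJ; split=> [|x y /set_mem/amalg_setE Jx /set_mem/amalg_setE Jy|
          x y /set_mem/amalg_setE Jx /set_mem/amalg_setE Jy];
  apply/mem_set/amalg_setE => /=.
- by rewrite rmorph1 subrr; apply/set_mem/idJ.1.
- have -> : x.2 - y.2 - f (x.1 - y.1) =
    -1 * (y.2 - f y.1) + (x.2 - f x.1).
    by rewrite mulN1r rmorphB [RHS]addrC !opprD !opprK addrACA.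
  by apply: ideal_add => //; apply: ideal_mull.
- have -> : x.2 * y.2 - f (x.1 * y.1) =
    y.2 * (x.2 - f x.1) + f x.1 * (y.2 - f y.1).
    by rewrite rmorphM !mulrBr [y.2 * x.2]mulrC [y.2 * f _]mulrC addrA subrK.
  by apply: ideal_add => //; apply: ideal_mull.
Qed.

(* The proof that J is an ideal is a parameter of the carrier so that the ring
   structure can be inferred from the type. *)
Definition amalg_ring of ideal J : Type := {x : R * T | x \in amalg_set}.

Variable idJ : ideal J.

HB.instance Definition _ := SubChoice.on (amalg_ring idJ).
HB.instance Definition _ :=
  GRing.SubChoice_isSubComPzRing.Build (R * T)%type [in amalg_set]
    (amalg_ring idJ) (amalg_subring_closed idJ).

End AmalgamatedRing.

Section AmalgamatedModule.
Variables (R T : comPzRingType) (f : {rmorphism R -> T}).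
Variables (J : set T) (M : lmodType R) (N : lmodType T).
(* phi is R-linear for N regarded as an R-module via f:
   phi (r *: m) = f r *: phi m. *)
Variable phi : {linear M -> N | f \; *:%R}.

(* F |><| J N as a subset of M * N *)
Definition amalg_mod_set (F : set M) : set (M * N) :=
  [set x | exists m n, [/\ F m, setsmul J [set: N] n & x = (m, phi m + n)]].

Lemma amalg_mod_setE F x :
  amalg_mod_set F x <-> F x.1 /\ setsmul J [set: N] (x.2 - phi x.1).
Proof.
split=> [[m [n [Fm Jn ->]]]|[Fx Jx]]; first by rewrite /= addrAC subrr add0r.
exists x.1, (x.2 - phi x.1); split=> //.
by rewrite [phi _ + _]addrC subrK; case: x Fx Jx.
Qed.

Lemma amalg_mod_zmod_closed : GRing.zmod_closed [in amalg_mod_set [set: M]].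
Proof.
split=> [|x y /set_mem/amalg_mod_setE[_ Jx] /set_mem/amalg_mod_setE[_ Jy]];
  apply/mem_set/amalg_mod_setE; split=> //=.
  by rewrite raddf0 subrr; exact: setsmul0.
have -> : x.2 - y.2 - phi (x.1 - y.1) =
  -1 *: (y.2 - phi y.1) + (x.2 - phi x.1).
  by rewrite scaleN1r raddfB [RHS]addrC !opprD !opprK addrACA.
by apply: setsmulD => //; apply: setsmulT_scale.
Qed.

Definition amalg_mod of ideal J : Type :=
  {x : M * N | x \in amalg_mod_set [set: M]}.

Variable idJ : ideal J.

HB.instance Definition _ := SubChoice.on (amalg_mod idJ).
HB.instance Definition _ :=
  GRing.SubChoice_isSubZmodule.Build (M * N)%type
    [in amalg_mod_set [set: M]] (amalg_mod idJ) amalg_mod_zmod_closed.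

Definition pair_scale (a : R * T) (x : M * N) : M * N :=
  (a.1 *: x.1, a.2 *: x.2).

(* On elements written as in the definition of the two amalgamations, the
   componentwise action is the usual formula. *)
Lemma pair_scaleE r j m n :
  pair_scale (r, f r + j) (m, phi m + n) =
  (r *: m, phi (r *: m) + f r *: n + j *: phi m + j *: n).
Proof.
by rewrite /pair_scale /= linearZ scalerDl !scalerDr !addrA.
Qed.

Lemma amalg_scale_subproof (F : set M) (a : R * T) (x : M * N) :
    (forall r m, F m -> F (r *: m)) ->
  amalg_set f J a -> amalg_mod_set F x -> amalg_mod_set F (pair_scale a x).
Proof.
move=> FZ [r [j [Jj ->]]] [m [n [Fm Jn ->]]]; rewrite pair_scaleE.
exists (r *: m), (f r *: n + j *: phi m + j *: n); split; first exact: FZ.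
  by do 2?apply: setsmulD; do ?[exact: setsmulT_scale | exact: setsmul1].
by rewrite !addrA.
Qed.

Definition amalg_scale (a : amalg_ring f idJ) (x : amalg_mod idJ) :
    amalg_mod idJ :=
  exist (fun x => x \in amalg_mod_set [set: M]) (pair_scale (\val a) (\val x))
    (mem_set (amalg_scale_subproof (F := [set: M]) (fun _ _ _ => I)
       (set_mem (valP a)) (set_mem (valP x)))).

Fact amalg_scaleA a b x :
  amalg_scale a (amalg_scale b x) = amalg_scale (a * b) x.
Proof. by apply/val_inj; rewrite /= /pair_scale /= !scalerA. Qed.

Fact amalg_scale1 : left_id 1 amalg_scale.
Proof.
by move=> x; apply/val_inj; rewrite /= /pair_scale /= !scale1r -surjective_pairing.
Qed.

Fact amalg_scaleDr : right_distributive amalg_scale +%R.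
Proof.
by move=> a x y; apply/val_inj; rewrite /= /pair_scale /= !scalerDr.
Qed.

Fact amalg_scaleDl x : {morph amalg_scale^~ x : a b / a + b}.
Proof.
by move=> a b; apply/val_inj; rewrite /= /pair_scale /= !scalerDl.
Qed.

HB.instance Definition _ :=
  GRing.Zmodule_isLmodule.Build (amalg_ring f idJ) (amalg_mod idJ)
    amalg_scaleA amalg_scale1 amalg_scaleDr amalg_scaleDl.

Definition amalg_submod (F : set M) : set (amalg_mod idJ) :=
  [set x | amalg_mod_set F (\val x)].

Lemma amalg_submod_submodule F : submodule F -> submodule (amalg_submod F).
Proof.
move=> subF; split=> [|a u v /set_mem Fu /set_mem Fv]; apply/mem_set.
  apply/amalg_mod_setE => /=; split; first exact/set_mem/subF.1.
  by rewrite raddf0 subrr; exact: setsmul0.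
have FZ r m : F m -> F (r *: m).
  by move=> /mem_set Fm; have /set_mem := subF.2 r m 0 Fm subF.1; rewrite addr0.
have FD m m' : F m -> F m' -> F (m + m').
  move=> /mem_set Fm /mem_set Fm'.
  by have /set_mem := subF.2 1 m m' Fm Fm'; rewrite scale1r.
have := amalg_scale_subproof FZ (set_mem (valP a)) Fu.
move=> [m [n [Fm Jn E]]]; case: Fv => [m' [n' [Fm' Jn' E']]].
exists (m + m'), (n + n'); split; first exact: FD.
  exact: setsmulD.
rewrite [\val _](_ : _ = pair_scale (val a) (val u) + \val v) // E E'.
by rewrite /GRing.add /= /add_pair /= raddfD addrACA.
Qed.

End AmalgamatedModule.

Arguments amalg_submod {R T f J M N} phi idJ F.

(* Main.v *)
Require Import Defs.
From HB Require Import structures.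
From mathcomp Require Import all_boot all_algebra.
From mathcomp Require Import boolp classical_sets.

(** Membership in [amalg_submod phi idJ F] depends only on the first component:
an element of the amalgamated module lies there exactly when its first
component lies in [F] ([amalg_submodE]). The action is componentwise and every
[m] in [M] is the first component of [(m, phi m)], so the 2-absorbing property
of [F] lifts to its amalgamation ([two_absorbing_amalg]). What remains in each
case is that [F] itself is 2-absorbing.

For an intersection of two primes [P1], [P2]: if [a b m] lies in the
intersection, then for each [i], either [a] or [b] is in [(Pi : M)], or [m] is
in [Pi]; every combination gives the conclusion. When [M = R x] is cyclic, [r]
is in [(F : M)] iff [r x] is in [F], so elements of [M] can be replaced by
scalars and the property of [(F : M)] carries over. When [F] is [P]-primary
and [a b m] is in [F] while [a m] and [b m] are not, both [a] and [b] are in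
[P], hence [a b M] is contained in [P^2 M], and so in [F]. *)

Set Implicit Arguments.
Unset Strict Implicit.
Unset Printing Implicit Defensive.

Import GRing.Theory.
Local Open Scope classical_set_scope.
Local Open Scope ring_scope.

Section TwoAbsorbing.
Variables (A : comPzRingType) (V : lmodType A).
Implicit Types F P : set V.

Lemma submodule_scale F a u : submodule F -> F u -> F (a *: u).
Proof.
move=> subF /mem_set Fu.
by have /set_mem := subF.2 a u 0 Fu subF.1; rewrite addr0.
Qed.

Lemma prime_submoduleM P a b m : prime_submodule P -> P ((a * b) *: m) ->
  [\/ colon P a, colon P b | P m].
Proof.
move=> [_ _ primeP]; rewrite -scalerA => /primeP[/primeP[Pm|Pb]|Pa].
- exact: Or33.
- exact: Or32.
- exact: Or31.
Qed.

Lemma submoduleI F P : submodule F -> submodule P -> submodule (F `&` P).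
Proof.
move=> [F0 FD] [P0 PD]; split=> [|a u v /set_mem[Fu Pu] /set_mem[Fv Pv]].
  by apply/mem_set; split; apply: set_mem.
by apply/mem_set; split; apply: set_mem; [apply: FD|apply: PD]; apply: mem_set.
Qed.

Lemma two_absorbing_primeI P1 P2 : prime_submodule P1 -> prime_submodule P2 ->
  two_absorbing_submodule (P1 `&` P2).
Proof.
move=> pr1 pr2; have [[sub1 prop1 _] [sub2 _ _]] := (pr1, pr2).
split=> [||a b m [/(prime_submoduleM pr1) abm1 /(prime_submoduleM pr2) abm2]].
- exact: submoduleI.
- by move=> I_T; apply: prop1; rewrite -subTset -I_T => u [].
have scale1 c := @submodule_scale P1 c m sub1.
have scale2 c := @submodule_scale P2 c m sub2.
have colonMr P c d : colon P c -> colon P (c * d).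
  by move=> Pc u; rewrite -scalerA.
have colonMl P c d : colon P d -> colon P (c * d).
  by rewrite mulrC; apply: colonMr.
case: abm1 abm2 => [a1|b1|m1] [a2|b2|m2].
- by apply: Or32; split; [apply: a1|apply: a2].
- by apply: Or31 => u; split; [apply: colonMr|apply: colonMl].
- by apply: Or32; split; [apply: a1|apply: scale2].
- by apply: Or31 => u; split; [apply: colonMl|apply: colonMr].
- by apply: Or33; split; [apply: b1|apply: b2].
- by apply: Or33; split; [apply: b1|apply: scale2].
- by apply: Or32; split; [apply: scale1|apply: a2].
- by apply: Or33; split; [apply: scale1|apply: b2].
- by apply: Or32; split; [apply: scale1|apply: scale2].
Qed.

Lemma colon_generator F x r : submodule F ->
  (forall m : V, exists s : A, m = s *: x) -> F (r *: x) -> colon F r.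
Proof.
move=> subF genx Frx m; have [s ->] := genx m.
by rewrite scalerA mulrC -scalerA; apply: submodule_scale.
Qed.

Lemma two_absorbing_cyclic F : submodule F -> cyclic_module V ->
  two_absorbing_ideal (colon F) -> two_absorbing_submodule F.
Proof.
move=> subF [x genx] [_ _ propF absF]; split=> // [F_T|a b m].
  by apply: propF; apply/seteqP; split=> // r _ m; rewrite F_T.
have [r ->] := genx m; rewrite scalerA => /(colon_generator subF genx)/absF.
case=> [Fab|Far|Fbr]; first exact: Or31.
- by apply: Or32; rewrite scalerA.
- by apply: Or33; rewrite scalerA.
Qed.

Lemma two_absorbing_primary F (P : set A) : ideal P -> P_primary P F ->
  submodule_mul (setsmul P [set: V]) (setsmul P [set: V]) `<=` F ->
  two_absorbing_submodule F.
Proof.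
move=> idP [[subF propF primF] radF] P2F; split=> // a b m Fabm.
have primP c u : F (c *: u) -> F u \/ P c.
  by rewrite -radF => /primF.
have Fa_bm : F (a *: (b *: m)) by rewrite scalerA.
have Fb_am : F (b *: (a *: m)) by rewrite scalerA mulrC.
have [Fbm|Pa] := primP _ _ Fa_bm; first exact: Or33.
have [Fam|Pb] := primP _ _ Fb_am; first exact: Or32.
apply: Or31 => u; apply: P2F; rewrite submodule_mulE//.
by apply: setsmul1 => //; apply: (@setsmul1 A A^o).
Qed.

End TwoAbsorbing.

Section Amalgamation.
Variables (R T : comPzRingType) (f : {rmorphism R -> T}) (J : set T).
Variables (idJ : ideal J) (M : lmodType R) (N : lmodType T).
Variable phi : {linear M -> N | f \; *:%R}.
Implicit Types F : set M.

Lemma amalg_submodE F (x : amalg_mod phi idJ) :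
  amalg_submod phi idJ F x <-> F (\val x).1.
Proof.
split=> [/amalg_mod_setE[]//|Fx]; apply/amalg_mod_setE; split=> //.
by have /set_mem/amalg_mod_setE[] := valP x.
Qed.

Lemma amalg_mod_fst_surj m : exists x : amalg_mod phi idJ, (\val x).1 = m.
Proof.
have phim : (m, phi m) \in amalg_mod_set J phi [set: M].
  by apply/mem_set/amalg_mod_setE; split=> //=; rewrite subrr; apply: setsmul0.
by exists (exist _ (m, phi m) phim).
Qed.

Lemma two_absorbing_amalg F : two_absorbing_submodule F ->
  two_absorbing_submodule (amalg_submod phi idJ F).
Proof.
move=> [subF propF absF]; split=> [|FJ_T|a b x].
- exact: amalg_submod_submodule.
- apply: propF; apply/seteqP; split=> // m _.
  by have [x <-] := amalg_mod_fst_surj m; apply/amalg_submodE; rewrite FJ_T.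
(* The first component of [(a * b) *: x] is [a.1 * b.1] acting on [x.1]. *)
move=> /amalg_submodE/(absF (\val a).1 (\val b).1)[Fab|Fax|Fbx].
- by apply: Or31 => y; apply/amalg_submodE; apply: Fab.
- by apply: Or32; apply/amalg_submodE.
- by apply: Or33; apply/amalg_submodE.
Qed.

End Amalgamation.

Theorem corollary3p2 (R T : comPzRingType) (f : {rmorphism R -> T})
    (J : set T) (idJ : ideal J) (M : lmodType R) (N : lmodType T)
    (phi : {linear M -> N | f \; *:%R}) (F : set M) (subF : submodule F) :
  [/\ (exists P1 P2 : set M,
         [/\ prime_submodule P1, prime_submodule P2, P1 <> P2 &
             F = P1 `&` P2]) ->
      two_absorbing_submodule (amalg_submod phi idJ F),
      cyclic_module M -> two_absorbing_ideal (colon F) ->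
      two_absorbing_submodule (amalg_submod phi idJ F) &
      forall P : set R,
        cyclic_module M -> prime_ideal P -> P_primary P F ->
        submodule_mul (setsmul P [set: M]) (setsmul P [set: M]) `<=` F ->
        two_absorbing_submodule (amalg_submod phi idJ F)].
Proof.
split.
- move=> [P1 [P2 [pr1 pr2 _ ->]]].
  exact/two_absorbing_amalg/two_absorbing_primeI.
- by move=> cycM absF; apply/two_absorbing_amalg/two_absorbing_cyclic.
- move=> P _ [idP _ _] primF P2F.
  exact/two_absorbing_amalg/(two_absorbing_primary idP).
Qed.
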